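(* Let $X$ be a compact metric space and $f:X\to X$ a minimal homeomorphism. Then $h_{\mathrm{top},a_\chi}(f)=0$ for every family of scales $\{a_\chi\}$ if and only if $f$ is topologically conjugate to a translation on a compact abelian group.
   Context: A family of scales is a family of functions $a_\chi:\mathbb R_+\to\mathbb R_+$, $\chi\in\mathbb R_+$, with $a_\chi(T)\to\infty$ as $T\to\infty$ for each $\chi$ and $a_\chi=o(a_{\chi'})$ whenever $\chi<\chi'$. Topological slow entropy of a homeomorphism $f$ of a compact metric space $X$: let $B_f^T(x,\epsilon)=\bigcap_{0\le t\le T}f^{-t}(B(f^t(x),\epsilon))$ ($t$ integer), let $N_{f,X}(\epsilon,T)$ be the minimal number of sets $B_f^T(x,\epsilon)$ needed to cover $X$, and $$h_{\mathrm{top},a_\chi}(f)=\lim_{\epsilon\to0}\sup\Big\{\chi:\limsup_{T\to\infty}\frac{N_{f,X}(\epsilon,T)}{a_\chi(T)}>0\Big\}$$ (with $\sup\emptyset=0$). *)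

(* Defs.v *)
From HB Require Import structures.
From mathcomp Require Import all_boot all_order all_algebra.
From mathcomp Require Import all_classical all_reals all_analysis.

Set Implicit Arguments.
Unset Strict Implicit.
Unset Printing Implicit Defensive.

Import Order.TTheory GRing.Theory Num.Theory.
Import numFieldNormedType.Exports.

Local Open Scope classical_set_scope.
Local Open Scope ring_scope.

(* Lets the Landau notations be used with the filter +oo on R. *)
Canonical pinfty_filter_on (R : numFieldType) :=
  FilterType (pinfty_nbhs R) proper_pinfty_nbhs.

Definition homeomorphism (X Y : topologicalType) (f : X -> Y) : Prop :=
  continuous f /\
  exists g : Y -> X, [/\ cancel f g, cancel g f & continuous g].

Definition minimal (X : topologicalType) (f : X -> X) : Prop :=
  forall A : set X, closed A -> f @` A = A -> A = set0 \/ A = [set: X].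

Definition top_conjugate (X Y : topologicalType) (f : X -> X) (g : Y -> Y) :
  Prop :=
  exists2 phi : X -> Y, homeomorphism phi & forall x, phi (f x) = g (phi x).

(* R_+ is read as the open half-line ]0, +oo[ (the standard scales T^chi and
   e^(chi T) require chi > 0): only the values a chi T with chi, T > 0
   matter. *)
Definition family_of_scales (R : realType) (a : R -> R -> R) : Prop :=
  [/\ forall chi T : R, 0 < chi -> 0 < T -> 0 < a chi T,
      forall chi : R, 0 < chi -> a chi T @[T --> +oo] --> +oo &
      forall chi chi' : R, 0 < chi -> chi < chi' -> a chi =o_+oo a chi'].

Section slow_entropy.
Context (R : realType) (X : metricType R) (f : X -> X).

Definition bowen_ball (T : R) (x : X) (e : R) : set X :=
  \bigcap_(t in [set t : nat | t%:R <= T])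
    iter t f @^-1` ball (iter t f x) e.

(* An infimum of natural numbers, hence attained as soon as finitely many
   Bowen balls suffice to cover X (always so in the compact case). *)
Definition cover_number (e T : R) : \bar R :=
  ereal_inf [set (n%:R)%:E | n in
    [set n : nat | exists2 s : seq X, size s = n &
       [set: X] `<=` \bigcup_(x in [set` s]) bowen_ball T x e]].

(* Taking the maximum with 0 only implements sup set0 = 0, since all the
   indices chi are positive. *)
Definition slow_entropy_at (a : R -> R -> R) (e : R) : \bar R :=
  maxe 0%E (ereal_sup [set chi%:E | chi in
    [set chi : R | 0 < chi /\
       (0 < limf_esup (fun T : R => cover_number e T * ((a chi T)^-1)%:E)
                      +oo%R)%E]]).

Definition top_slow_entropy (a : R -> R -> R) : \bar R :=
  lim (slow_entropy_at a e @[e --> 0^'+]).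

End slow_entropy.

(* Main.v *)
(* If [f] is conjugate to a translation of a compact group [G], compactness of
   [G] makes the iterates of [f] equicontinuous, so finitely many orbitwise
   balls of radius [e] cover [X], uniformly in time, and no scale is reached.

   Conversely, if some cover number [N(e, T)] were unbounded in [T], it would
   have growth rate 1 for the scales [N(e, T) ^ chi]. So all cover numbers are
   bounded, hence [X] is a finite union of sets of small diameter for the
   distance [sup_(n >= 0) d(f^n x, f^n y)]; the closure of one of them has
   nonempty interior, and by minimality every orbit enters it, so that the
   iterates of [f] are equicontinuous. The operation
   [f^m x0 + f^n x0 = f^(m + n) x0] on a (dense) forward orbit then extends to a
   continuous commutative monoid law on [X], in which [f] is the translation by
   [f x0]; minimality provides inverses, as the closed set [x + X] is
   [f]-invariant, and compactness makes inversion continuous. *)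

From HB Require Import structures.
Require Import Defs.
From mathcomp Require Import all_boot all_order all_algebra.
From mathcomp Require Import all_classical all_reals all_analysis.
From mathcomp Require Import ring.
Import Order.TTheory GRing.Theory Num.Theory.
Import numFieldNormedType.Exports.
Local Open Scope classical_set_scope.
Local Open Scope ring_scope.

Set Implicit Arguments.
Unset Strict Implicit.
Unset Printing Implicit Defensive.

(** Near-covering compactness is applied to the filter of finite sequences directed by inclusion:
    near [x], any sequence containing [x] covers. *)
Lemma compact_finite_nbhs_cover {X : topologicalType} (U : X -> set X) :
  compact [set: X] -> (forall x, nbhs x (U x)) ->
  exists s : seq X, [set: X] `<=` \bigcup_(x in [set` s]) U x.
Proof.
move=> /compact_near_coveringP cX Unbhs.
pose F : set_system (seq X) :=
  filter_from [set: seq X] (fun s => [set s' : seq X | {subset s <= s'}]).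
have FF : ProperFilter F.
  apply: filter_from_proper; last by move=> s _; exists s.
  apply: filter_from_filter; first by exists nil.
  move=> s1 s2 _ _; exists (s1 ++ s2) => // s' /= s12; split=> x xs;
    by apply: s12; rewrite mem_cat xs ?orbT.
have /(cX _ F (fun s => \bigcup_(x in [set` s]) U x)) : forall x, [set: X] x ->
    \near x & F, (\bigcup_(x in [set` F]) U x) x.
  move=> x _; exists (U x, [set s : seq X | x \in s]) => /=.
    by split; [exact: Unbhs|exists [:: x] => //= s; apply; rewrite inE].
  by move=> [y s] /= [Uxy xs]; exists x.
by move=> /filter_ex[s Xs]; exists s.
Qed.

(** * Bowen balls and cover numbers *)

Section cover_number.
Context {R : realType} {X : metricType R} (f : X -> X).
Implicit Types (e T : R) (s : seq X).

Definition bowen_cover e T s :=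
  [set: X] `<=` \bigcup_(x in [set` s]) bowen_ball f T x e.

Lemma cover_number_le e T s :
  bowen_cover e T s -> (cover_number f e T <= (size s)%:R%:E)%E.
Proof. by move=> sX; apply: ereal_inf_lbound; exists (size s) => //; exists s. Qed.

Lemma cover_number_ltP e T (x : \bar R) : (cover_number f e T < x)%E ->
  exists2 s, bowen_cover e T s & ((size s)%:R%:E < x)%E.
Proof.
by move=> /ereal_inf_lt[_ [n [s <- sX] <-]] sx; exists s.
Qed.

Lemma bowen_ball_sub e e' T T' x : e <= e' -> T <= T' ->
  bowen_ball f T' x e `<=` bowen_ball f T x e'.
Proof.
move=> ee' TT' y xy t tT; apply: (le_ball ee').
by apply: xy; exact: le_trans tT TT'.
Qed.

Lemma le_cover_number e e' T T' : e <= e' -> T <= T' ->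
  (cover_number f e' T <= cover_number f e T')%E.
Proof.
move=> ee' TT'; apply: le_ereal_inf => _ [n [s sn sX] <-]; exists n => //.
exists s => // y /sX[x xs xy]; exists x => //.
exact: (bowen_ball_sub ee' TT' xy).
Qed.

Lemma cover_number_ge1 e T : [set: X] !=set0 -> (1 <= cover_number f e T)%E.
Proof.
move=> [x0 _]; apply: le_ereal_inf_tmp => _ [n [s <- sX] <-].
rewrite lee_fin ler1n; case: s sX => // /(_ x0 I)[x].
by rewrite /= in_nil.
Qed.

Lemma continuous_iter n : continuous f -> continuous (iter n f).
Proof.
move=> cf; elim: n => [|n IH] x; first exact: cvg_id.
exact: (continuous_comp (IH x) (cf _)).
Qed.

Lemma near_iter_ball n x e : continuous f -> 0 < e ->
  \forall y \near x, forall t, (t < n)%N -> ball (iter t f x) e (iter t f y).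
Proof.
move=> cf e0; elim: n => [|n IH]; first exact: nearW.
have Hn : \forall y \near x, ball (iter n f x) e (iter n f y).
  apply: (@continuous_iter n cf x); exact: nbhsx_ballx.
near=> y => t; rewrite ltnS leq_eqVlt => /orP[/eqP ->|].
  by near: y.
by move: t; near: y.
Unshelve. all: by end_near. Qed.

Lemma nbhs_bowen_ball e T x : continuous f -> 0 < e ->
  nbhs x (bowen_ball f T x e).
Proof.
move=> cf e0; have [n Tn] : exists n : nat, T < n%:R.
  by exists (Num.bound `|T|); rewrite (le_lt_trans (ler_norm _))// archi_boundP.
apply: filterS (near_iter_ball n x cf e0) => y xy t tT; apply: xy.
by rewrite -(ltr_nat R) (le_lt_trans tT).
Qed.

Lemma cover_number_fin_num e T : compact [set: X] -> continuous f -> 0 < e ->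
  cover_number f e T \is a fin_num.
Proof.
move=> cX cf e0.
have [s sX] := compact_finite_nbhs_cover cX (fun x => nbhs_bowen_ball T x cf e0).
rewrite fin_numE; apply/andP; split.
  apply/eqP => h; have : (0 <= cover_number f e T)%E.
    by apply: le_ereal_inf_tmp => _ [n _ <-]; rewrite lee_fin.
  by rewrite h.
by rewrite -ltey (le_lt_trans (cover_number_le sX))// ltry.
Qed.

End cover_number.

(** * Scales built from the powers of a divergent function *)

Section scales.
Context {R : realType}.

Lemma powR_cvg_pinfty (c : R -> R) (chi : R) : (forall T, 1 <= c T) ->
  c T @[T --> +oo] --> +oo -> 0 < chi -> c T `^ chi @[T --> +oo] --> +oo.
Proof.
move=> c1 coo chi0; apply/cvgryPge => M.
near=> T.
have [M0|M0] := leP M 0; first by rewrite (le_trans M0)// powR_ge0.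
have -> : M = (M `^ chi^-1) `^ chi.
  by rewrite -powRrM mulVf ?gt_eqF// powRr1// ltW.
rewrite ge0_ler_powR ?nnegrE ?powR_ge0//; first exact: ltW.
  by rewrite (le_trans ler01).
near: T; move/cvgryPge : coo; exact.
Unshelve. all: by end_near. Qed.

(** For [chi < chi'] the two scales differ by a factor that is the power of [c T] with exponent
    [chi' - chi > 0], which diverges. *)
Lemma powR_family_of_scales (c : R -> R) : (forall T, 1 <= c T) ->
  c T @[T --> +oo] --> +oo -> family_of_scales (fun chi T => c T `^ chi).
Proof.
move=> c1 coo; have c0 T : 0 < c T by rewrite (lt_le_trans ltr01).
split => [chi T _ _|chi chi0|chi chi' chi0 chichi'].
- by rewrite powR_gt0.
- exact: powR_cvg_pinfty.
have /cvgryPge coo' : c T `^ (chi' - chi) @[T --> +oo] --> +oo.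
  by apply: powR_cvg_pinfty => //; rewrite subr_gt0.
apply/eqoP => e e0; near=> T.
rewrite !ger0_norm ?powR_ge0//.
have -> : chi' = (chi' - chi) + chi by rewrite subrK.
rewrite powRD ?(gt_eqF (c0 T)) ?implybT// mulrA ler_peMl ?powR_ge0//.
rewrite -ler_pdivrMl// mulr1.
by near: T; exact: coo'.
Unshelve. all: by end_near. Qed.

End scales.

(** * Vanishing slow entropy and bounded cover numbers *)

Section slow_entropy.
Context {R : realType} {X : metricType R} (f : X -> X).
Implicit Types (a : R -> R -> R) (e : R).

Lemma le_slow_entropy_at a e e' : family_of_scales a -> e <= e' ->
  (slow_entropy_at f a e' <= slow_entropy_at f a e)%E.
Proof.
move=> [a0 _ _] ee'; rewrite ge_max le_max lexx /= le_max; apply/orP; right.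
apply: le_ereal_sup => _ [chi [chi0 h] <-]; exists chi => //; split => //.
apply: (lt_le_trans h); apply: le_ereal_inf_tmp => _ [V Voo <-].
(* Positivity of a scale is given only at positive times, so neighbourhoods of infinity are cut down
   to these. *)
pose W := V `&` [set T | 0 < T].
have Woo : pinfty_nbhs R W by apply: filterI => //; exact: nbhs_pinfty_gt.
apply: (@le_trans _ _ (ereal_sup [set (cover_number f e' T * ((a chi T)^-1)%:E)%E
    | T in W])); first by apply: ereal_inf_lbound; exists W.
apply: ge_ereal_sup => _ [T [VT T0] <-].
apply: (@le_trans _ _ (cover_number f e T * ((a chi T)^-1)%:E)%E); last first.
  by apply: ereal_sup_ubound; exists T.
by rewrite lee_wpmul2r ?lee_fin ?invr_ge0 ?(ltW (a0 _ _ _ _))// le_cover_number.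
Qed.

(** Cover numbers grow as [e] decreases, so the limit at 0 is monotone and equals the supremum. *)
Lemma top_slow_entropyE a : family_of_scales a ->
  top_slow_entropy f a = ereal_sup [set slow_entropy_at f a e | e in [set e | 0 < e]].
Proof.
move=> fa; apply/cvg_lim => //.
rewrite (_ : [set e | 0 < e] = [set` `]0, +oo[]); last first.
  by apply/seteqP; split => e; rewrite /= in_itv/= andbT.
by apply: (nonincreasing_at_right_cvge +oo%O) => // e e' _ _; exact: le_slow_entropy_at.
Qed.

Lemma slow_entropy_at_bounded a e (K : R) : family_of_scales a ->
  (forall T, (cover_number f e T <= K%:E)%E) -> slow_entropy_at f a e = 0%E.
Proof.
move=> [a0 aoo _] eK; apply/eqP; rewrite eq_le le_max lexx andbT ge_max lexx/=.
apply: ge_ereal_sup => _ [chi [chi0 +] <-].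
rewrite ltNge => /negP[]; apply/lee_addgt0Pr => d d0; rewrite add0e.
have /cvgryPge/(_ (K / d)) aK := aoo chi chi0.
pose W := [set T : R | 0 < T] `&` [set T | K / d <= a chi T].
have Woo : pinfty_nbhs R W by apply: filterI => //; exact: nbhs_pinfty_gt.
apply: (@le_trans _ _ (ereal_sup [set (cover_number f e T * ((a chi T)^-1)%:E)%E
    | T in W])); first by apply: ereal_inf_lbound; exists W.
apply: ge_ereal_sup => _ [T [T0 KT] <-].
have aT0 := a0 chi T chi0 T0.
apply: (@le_trans _ _ (K%:E * ((a chi T)^-1)%:E)%E).
  by rewrite lee_wpmul2r ?eK// lee_fin invr_ge0 ltW.
by rewrite -EFinM lee_fin ler_pdivrMr// mulrC -ler_pdivrMr.
Qed.

Lemma top_slow_entropy_bounded a : family_of_scales a ->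
  (forall e, 0 < e -> exists K : R, forall T, (cover_number f e T <= K%:E)%E) ->
  top_slow_entropy f a = 0%E.
Proof.
move=> fa fK; rewrite top_slow_entropyE//.
rewrite (_ : [set _ | _ in _] = [set 0%E]) ?ereal_sup1//.
apply/seteqP; split => [_ [e + <-]|_ ->] /=.
  by move=> /fK[K eK]; exact: slow_entropy_at_bounded fa eK.
have [K eK] := fK 1 ltr01; exists 1 => /=; first exact: ltr01.
exact: slow_entropy_at_bounded fa eK.
Qed.

Lemma cover_number_bounded : [set: X] !=set0 -> compact [set: X] ->
  continuous f ->
  (forall a, family_of_scales a -> top_slow_entropy f a = 0%E) ->
  forall e, 0 < e -> exists K : nat, forall T, (cover_number f e T <= K%:R%:E)%E.
Proof.
move=> X0 cX cf h e e0; apply: contrapT => /forallNP nK.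
pose c T : R := fine (cover_number f e T).
have cE T : (c T)%:E = cover_number f e T.
  by rewrite fineK// cover_number_fin_num.
have c1 T : 1 <= c T by rewrite -lee_fin cE cover_number_ge1.
(* Cover numbers are nondecreasing in [T], so an unbounded one diverges. *)
have coo : c T @[T --> +oo] --> +oo.
  apply/cvgryPge => M.
  have /existsNP[T /negP] := nK (Num.bound `|M|).
  rewrite -cE lee_fin -ltNge => MT.
  near=> T'; have TT' : T <= T' by near: T'; apply: nbhs_pinfty_ge; exact: num_real.
  apply: (@le_trans _ _ (c T)).
    rewrite (le_trans (ler_norm _))// (le_trans _ (ltW MT))// ltW//.
    by rewrite archi_boundP.
  by rewrite -lee_fin !cE le_cover_number.
have fa := powR_family_of_scales c1 coo.
have := h _ fa; rewrite top_slow_entropyE// => h0.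
(* At index 1 the scale is [c] itself and the quotient is constantly 1, so the entropy is at least
   1. *)
have : (1 <= 0 :> \bar R)%E; last by rewrite lee_fin ler10.
rewrite -[leRHS]h0; apply: (@le_trans _ _ (slow_entropy_at f (fun chi T => c T `^ chi) e)).
  rewrite le_max; apply/orP; right; apply: ereal_sup_ubound.
  exists 1 => //; split => //; apply: (@lt_le_trans _ _ 1%E) => //.
  apply: le_ereal_inf_tmp => _ [V /filter_ex[T VT] <-].
  apply: ereal_sup_ubound; exists T => //.
  by rewrite -cE -EFinM powRr1 ?(le_trans ler01)// divff// gt_eqF// (lt_le_trans ltr01).
by apply: ereal_sup_ubound; exists e.
Unshelve. all: by end_near. Qed.

End slow_entropy.

(** * Equicontinuity of the iterates *)

Definition equicontinuous_iter {R : realType} {X : metricType R} (f : X -> X) :=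
  forall (x : X) (e : R), 0 < e ->
    \forall y \near x, forall n, ball (iter n f x) e (iter n f y).

Section equicontinuity.
Context {R : realType} {X : metricType R} (f : X -> X).
Implicit Types (e T : R) (s : seq X).

(** The neighbourhoods given by equicontinuity do not depend on time, so one finite cover by them
    serves every [T]. *)
Lemma equicontinuous_cover_number_bounded : compact [set: X] ->
  equicontinuous_iter f ->
  forall e, 0 < e -> exists K : R, forall T, (cover_number f e T <= K%:E)%E.
Proof.
move=> cX ef e e0.
have [s sX] := compact_finite_nbhs_cover cX (fun x => ef x e e0).
exists (size s)%:R => T; apply: cover_number_le => y /sX[x xs xy].
by exists x => // t _; exact: xy.
Qed.

(** Iterates become translations by [g *+ n]. Joint continuity of the translated map and compactness
    of [G] give a neighbourhood of [x] valid for all translations at once. *)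
Lemma translation_equicontinuous_iter (G : topologicalZmodType) (g : G) :
  compact [set: G] -> top_conjugate f (fun x : G => g + x) ->
  equicontinuous_iter f.
Proof.
move=> cG [phi [cphi [psi [phiK psiK cpsi]]] phif] x e e0.
have fE n y : iter n f y = psi (g *+ n + phi y).
  apply: (can_inj phiK); rewrite psiK; elim: n => [|n IH] /=.
    by rewrite add0r.
  by rewrite phif IH addrA mulrS.
have cH (h : G) : psi (w.1 + phi w.2) @[w --> (h, x)] --> psi (h + phi x).
  apply: (@cvg_comp _ _ _ (fun w : G * X => w.1 + phi w.2) psi); last exact: cpsi.
  apply: (@cvg_comp _ _ _ (fun w : G * X => (w.1, phi w.2))
    (fun w : G * G => w.1 + w.2)); last exact: (@add_continuous G (h, phi x)).
  apply: cvg_pair; first exact: cvg_fst.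
  by apply: cvg_comp; [exact: cvg_snd|exact: cphi].
have /compact_near_coveringP cGn := cG.
suff : \forall y \near x, [set: G] `<=`
    (fun h => ball (psi (h + phi x)) e (psi (h + phi y))).
  by apply: filterS => y Uy n; rewrite !fE; exact: Uy.
apply: cGn => h _.
(* Halving is needed because the images of [x] and [y] under the translation by [k] are both
   compared with [psi (h + phi x)]. *)
have e20 : 0 < e / 2 by rewrite divr_gt0.
have [[A B] /= [hA xB] AB] := iffLR (cvg_ballP _ _) (cH h) _ e20.
exists (A, B) => // -[k y] /= [Ak By].
apply: (@ball_splitr _ _ (psi (h + phi x))).
  by apply: (AB (k, x)); split => //=; exact: nbhs_singleton.
by apply: (AB (k, y)).
Qed.

End equicontinuity.

(** * Density of forward orbits *)

Section minimal_orbit.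
Context {X : topologicalType} (f : X -> X).
Hypotheses (cX : compact [set: X]) (hf : homeomorphism f) (mf : minimal f).

(* The omega-limit set of [x] is closed, nonempty and [f]-invariant. *)
Lemma minimal_orbit_dense (x y : X) (U : set X) : nbhs y U ->
  exists n, U (iter n f x).
Proof.
move=> yU; have [cf [g [fK gK cg]]] := hf.
pose A := cluster (iter n f x @[n --> \oo]).
have fA z : A z -> A (f z).
  move=> Az V W [N _ NV] zW.
  have [||w [Vw Ww]] := Az (f @^-1` V) (f @^-1` W); last by exists (f w).
    by exists N => // n /= Nn; apply: (NV n.+1); exact: leqW.
  exact: cf.
have gA z : A z -> A (g z).
  move=> Az V W [N _ NV] zW.
  have [||w [Vw Ww]] := Az (g @^-1` V) (g @^-1` W); last by exists (g w).
    (* [g] moves the orbit back by one step, so the tail starts one index later. *)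
    by exists N.+1 => // -[//|n] /= Nn; rewrite fK; exact: NV.
  exact: cg.
have [||A0|AT] := mf (A := A).
- by rewrite /A clusterE; apply: closed_bigI => B _; exact: closed_closure.
- apply/seteqP; split=> [_ [z Az <-]|z Az]; first exact: fA.
  by exists (g z); [exact: gA|exact: gK].
- have [|z [_]] := cX (F := iter n f x @[n --> \oo]) _; first exact: filterT.
  by rewrite -/A A0.
- have Ay : A y by rewrite AT.
  have [|_ [[n _ <-] Un]] := Ay (range (fun n => iter n f x)) U _ yU; last by exists n.
  by exists 0 => // n _; exists n.
Qed.

End minimal_orbit.

(** * From bounded cover numbers to equicontinuity *)

Section bounded_cover_number.
Context {R : realType} {X : metricType R} (f : X -> X).
Implicit Types (e T : R) (s : seq X).

(** A finite Baire argument: either [W] lies in the closure of the first set, or removing that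
    closure leaves a nonempty open set covered by the others. *)
Lemma finite_cover_closure_interior (C : X -> set X) s (W : set X) :
  open W -> W !=set0 -> W `<=` \bigcup_(x in [set` s]) C x ->
  exists x U, [/\ open U, U !=set0 & U `<=` closure (C x)].
Proof.
elim: s W => [W _ [w Ww] /(_ w Ww)[x]|x s IH W oW W0 WC]; first by rewrite /= in_nil.
have [WCx|/existsNP[w /not_implyP[Ww Cxw]]] := pselect (W `<=` closure (C x)).
  by exists x, W.
apply: (IH (W `\` closure (C x))); last 2 first.
- by exists w.
- move=> y [/WC[z]] /=; rewrite inE => /orP[/eqP ->|zs] Cz Cxy; last by exists z.
  by case: Cxy; exact: subset_closure.
- by apply: openI => //; apply: closed_openC; exact: closed_closure.
Qed.

(* Among more than [K] points, two are in the same of the [K] Bowen balls of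
   radius [e] covering [X], so a [2e]-separated set for the orbitwise sup
   distance has at most [K] points. *)
Lemma bounded_cover_number_finite_net e (K : nat) :
  (forall T, (cover_number f e T <= K%:R%:E)%E) ->
  exists s, forall y, exists2 x, x \in s &
    forall n, ball (iter n f x) (e + e) (iter n f y).
Proof.
move=> eK; apply: contrapT => /forallNP nK.
(* Separation is required within a finite horizon [m], as covers are available only for finite [T];
   the horizon grows as points are added. *)
pose sep m : rel X := fun x y =>
  `[< exists2 n, (n <= m)%N & ~ ball (iter n f y) (e + e) (iter n f x) >].
have [s [m [sK sep_s]]] : exists s m, size s = K.+1 /\ pairwise (sep m) s.
  elim: K.+1 => [|k [s [m [sk sep_s]]]]; first by exists [::], 0.
  have /existsNP[y /forall2NP ys] := nK s.
  have [m' sm'] : exists m', all (sep m' y) s.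
    have {}ys x : x \in s -> exists n, ~ ball (iter n f x) (e + e) (iter n f y).
      by move=> xs; case: (ys x) => // /existsNP.
    elim: s ys {sk sep_s} => [|x s IH] ys; first by exists 0.
    have [|m1 sm1] := IH; first by move=> z zs; apply: ys; rewrite inE zs orbT.
    have [|n xyn] := ys x; first by rewrite mem_head.
    exists (maxn n m1) => /=; apply/andP; split.
      by apply/asboolP; exists n => //; exact: leq_maxl.
    apply: sub_all sm1 => z /asboolP[k' k'm1 zk']; apply/asboolP; exists k' => //.
    by rewrite (leq_trans k'm1)// leq_maxr.
  have sepW m1 m2 : (m1 <= m2)%N -> subrel (sep m1) (sep m2).
    move=> m12 u v /asboolP[n nm1 uv]; apply/asboolP; exists n => //.
    exact: leq_trans m12.
  exists (y :: s), (maxn m' m); split => /=; first by rewrite sk.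
  apply/andP; split.
    by apply: sub_all sm' => z; apply: sepW; exact: leq_maxl.
  by apply: sub_pairwise sep_s; apply: sepW; exact: leq_maxr.
have /cover_number_ltP[s' s'X] : (cover_number f e m%:R < K.+1%:R%:E)%E.
  by rewrite (le_lt_trans (eK _))// lte_fin ltr_nat.
rewrite lte_fin ltr_nat ltnNge => /negP; apply; rewrite -sK.
have /choice[c cP] : forall y, exists x, x \in s' /\ bowen_ball f m%:R x e y.
  by move=> y; have [x xs' xy] := s'X y I; exists x.
rewrite -(size_map c); apply: uniq_leq_size.
  rewrite uniq_pairwise pairwise_map; apply: sub_pairwise sep_s.
  move=> x y /asboolP[n nm]; apply: contra_notN => /eqP cxy.
  have nmR : n%:R <= m%:R :> R by rewrite ler_nat.
  apply: (@ball_triangle _ _ (iter n f (c x))); last exact: (cP x).2 n nmR.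
  by rewrite cxy; apply: ball_sym; exact: (cP y).2 n nmR.
by move=> _ /mapP[y _ ->]; exact: (cP y).1.
Qed.

Lemma bounded_cover_number_equicontinuous : [set: X] !=set0 ->
  compact [set: X] -> homeomorphism f -> minimal f ->
  (forall e, 0 < e -> exists K : nat, forall T, (cover_number f e T <= K%:R%:E)%E) ->
  equicontinuous_iter f.
Proof.
move=> X0 cX hf mf bf x e e0; have cf := hf.1.
(* A class of the net has orbitwise radius [2d] about [z], its closure stays within [3d], and two
   points of the closure are within [6d = e]. *)
pose d := e / 6; have d0 : 0 < d by rewrite divr_gt0.
have [K /bounded_cover_number_finite_net[s sX]] := bf d d0.
have [|z [U [oU [u Uu] Uz]]] := finite_cover_closure_interior
  (C := fun z => [set y | forall n, ball (iter n f z) (d + d) (iter n f y)])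
  (s := s) openT X0.
  by move=> y _; have [z zs zy] := sX y; exists z.
have Uz' y n : U y -> ball (iter n f z) (d + d + d) (iter n f y).
  move=> /Uz zy; have : nbhs y (iter n f @^-1` ball (iter n f y) d).
    by apply: continuous_iter => //; exact: nbhsx_ballx.
  move=> /zy[w [zw yw]]; apply: (ball_triangle (zw n)); exact: ball_sym.
have dE : e = (d + d + d) + (d + d + d) by rewrite /d; field.
have Ue y y' n : U y -> U y' -> ball (iter n f y) e (iter n f y').
  move=> Uy Uy'; rewrite dE; apply: ball_triangle (Uz' _ _ Uy').
  by apply: ball_sym; exact: Uz'.
have [m Um] := minimal_orbit_dense cX hf mf x (open_nbhs_nbhs (conj oU Uu)).
(* Before the entrance time [m] only finitely many iterates matter; from [m] on, both orbits have
   passed through [U] at time [m]. *)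
near=> y => n; have [nm|mn] := ltnP n m.
  by move: n nm; near: y; exact: near_iter_ball.
rewrite -(subnK mn) !iterD; apply: Ue => //; near: y.
by apply: continuous_iter => //; exact: open_nbhs_nbhs.
Unshelve. all: by end_near. Qed.

End bounded_cover_number.

(** * Construction of the compact abelian group *)

Lemma compact_group_transport (X : topologicalType) (zero : X)
    (opp : X -> X) (add : X -> X -> X) :
  hausdorff_space X -> compact [set: X] ->
  associative add -> commutative add -> left_id zero add ->
  left_inverse zero opp add -> continuous (fun z : X * X => add z.1 z.2) ->
  continuous opp ->
  exists (G : topologicalZmodType) (phi : X -> G),
    [/\ hausdorff_space G, compact [set: G], homeomorphism phi &
        {morph phi : x y / add x y >-> x + y}].
Proof.
move=> hX cX addA addC add0 addN cadd copp.
pose Z := GRing.isZmodule.Build X addA addC add0 addN.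
pose P : PreTopologicalZmodule.type := HB.pack X Z.
pose G : topologicalZmodType := HB.pack X Z
  (PreTopologicalNmodule_isTopologicalNmodule.Build P cadd)
  (TopologicalNmodule_isTopologicalZmodule.Build P copp).
(* [G] keeps the carrier and the topology of [X], so the identity serves as [phi]. *)
exists G, (idfun : X -> G); split => //; split; first by move=> x; exact: cvg_id.
by exists (idfun : G -> X); split => // x; exact: cvg_id.
Qed.

Section orbit_addition.
Context {R : realType} {X : metricType R} (f : X -> X) (x0 : X).
Hypotheses (cX : compact [set: X]) (hf : homeomorphism f) (mf : minimal f)
  (ef : equicontinuous_iter f).

Let p n := iter n f x0.

Let cf : continuous f. Proof. exact: hf.1. Qed.

Let p_dense (x : X) (d : R) : 0 < d -> exists n, ball x d (p n).
Proof. by move=> d0; apply: (minimal_orbit_dense cX hf mf x0); exact: nbhsx_ballx. Qed.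

(** The limit of [p (m + n)] as [p m] tends to [x] and [p n] to [y], as a relation: continuity and
    uniqueness can then precede existence. *)
Let is_orbit_sum (x y z : X) :=
  forall e : R, 0 < e -> exists2 d : R, 0 < d &
  forall m n, ball x d (p m) -> ball y d (p n) -> ball z e (p (m + n)).

Let ball_eq (x y : X) : (forall e : R, 0 < e -> ball x e y) -> x = y.
Proof.
move=> xy; apply: mdist_positivity; apply/eqP; rewrite eq_le mdist_ge0 andbT.
apply/ler_addgt0Pl => e /xy; rewrite ballEmdist addr0; exact: ltW.
Qed.

(** Orbit points close enough to [x'] and [y'] are also close to [x] and [y], so a single
    [p (m + n)] is near both [z] and [z']. *)
Let orbit_sum_continuous x y z (e : R) : is_orbit_sum x y z -> 0 < e ->
  exists2 d : R, 0 < d & forall x' y' z', is_orbit_sum x' y' z' ->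
    ball x d x' -> ball y d y' -> ball z e z'.
Proof.
move=> xyz e0; have e20 : 0 < e / 2 by rewrite divr_gt0.
have [d d0 dP] := xyz _ e20; have d20 : 0 < d / 2 by rewrite divr_gt0.
exists (d / 2) => // x' y' z' xyz' xx' yy'.
have [d' d'0 d'P] := xyz' _ e20.
pose r := Num.min (d / 2) d'; have r0 : 0 < r by rewrite lt_min d20.
have [m x'm] := p_dense x' r0; have [n y'n] := p_dense y' r0.
have rd : r <= d / 2 by rewrite ge_min lexx.
have rd' : r <= d' by rewrite ge_min lexx orbT.
apply: (@ball_splitl _ _ (p (m + n))); last first.
  by apply: d'P; apply: le_ball rd' _ _.
apply: dP; apply: ball_split; first exact: xx'.
- exact: le_ball rd _ x'm.
- exact: yy'.
- exact: le_ball rd _ y'n.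
Qed.

Let orbit_sum_unique x y z z' : is_orbit_sum x y z -> is_orbit_sum x y z' -> z = z'.
Proof.
move=> xyz xyz'; apply: ball_eq => e e0.
have [d d0 dP] := orbit_sum_continuous xyz e0.
by apply: dP xyz' _ _; exact: ballxx.
Qed.

(* Equicontinuity at [x] and at [y] makes [p (m + n)] Cauchy as [p m] tends to
   [x] and [p n] tends to [y]. *)
Let orbit_sum_exists x y : exists z, is_orbit_sum x y z.
Proof.
pose F : set_system X := filter_from [set d : R | 0 < d] (fun d =>
  [set w | exists m n, [/\ ball x d (p m), ball y d (p n) & w = p (m + n)]]).
have FF : ProperFilter F.
  apply: filter_from_proper => [|d d0]; last first.
    have [m xm] := p_dense x d0; have [n yn] := p_dense y d0.
    by exists (p (m + n)), m, n.
  apply: filter_from_filter; first by exists 1; exact: ltr01.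
  move=> d d' d0 d'0; exists (Num.min d d') => /=; first by rewrite lt_min d0.
  have le1 : Num.min d d' <= d by rewrite ge_min lexx.
  have le2 : Num.min d d' <= d' by rewrite ge_min lexx orbT.
  by move=> w [m [n [xm yn ->]]]; split; exists m, n; split => //;
    apply: le_ball; eassumption.
have [z [_ Fz]] := cX FF filterT.
exists z => e e0.
(* Five steps of size [r]: from [z] to [p (m' + n')], through [iter m' f y] to [p (m' + n)], then
   through [iter n f x] to [p (m + n)]. *)
pose r := e / 5; have r0 : 0 < r by rewrite divr_gt0.
have [/= d1 d10 d1P] := (nbhs_ballP _ _).1 (ef x r0).
have [/= d2 d20 d2P] := (nbhs_ballP _ _).1 (ef y r0).
pose d := Num.min d1 d2; have d0 : 0 < d by rewrite lt_min d10.
have dd1 : d <= d1 by rewrite ge_min lexx.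
have dd2 : d <= d2 by rewrite ge_min lexx orbT.
have [|w [[m' [n' [xm' yn' ->]]] zw]] :=
  Fz [set w | exists m n, [/\ ball x d (p m), ball y d (p n) & w = p (m + n)]]
    (ball z r) _ (nbhsx_ballx _ _ r0); first by exists d.
exists d => // m n xm yn.
have -> : e = (r + (r + r)) + (r + r) by rewrite /r; field.
have fx k l : ball x d (p k) -> ball (iter l f x) r (p (k + l)).
  by move=> /(le_ball dd1)/d1P; rewrite /p addnC iterD; exact.
have fy k l : ball y d (p k) -> ball (iter l f y) r (p (l + k)).
  by move=> /(le_ball dd2)/d2P; rewrite /p iterD; exact.
apply: (@ball_triangle _ _ (p (m' + n))).
  apply: (ball_triangle zw); apply: ball_triangle (fy _ _ yn).
  by apply: ball_sym; exact: fy.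
apply: ball_triangle (fx _ _ xm); apply: ball_sym; exact: fx.
Qed.

Let add x y := projT1 (cid (orbit_sum_exists x y)).

Let addP x y : is_orbit_sum x y (add x y).
Proof. by rewrite /add; case: cid. Qed.

Let add_unique x y z : is_orbit_sum x y z -> add x y = z.
Proof. by move=> xyz; exact: orbit_sum_unique (addP x y) xyz. Qed.

Let add_continuous : continuous (fun w : X * X => add w.1 w.2).
Proof.
move=> [x y]; apply/cvg_ballP => e e0.
have [d d0 dP] := orbit_sum_continuous (addP x y) e0.
exists (ball x d, ball y d); first by split; exact: nbhsx_ballx.
by move=> [x' y'] [/= xx' yy']; apply: dP xx' yy'; exact: addP.
Qed.

Let addr_continuous y : continuous (add^~ y).
Proof.
move=> x; apply/cvg_ballP => e e0.
have [d d0 dP] := orbit_sum_continuous (addP x y) e0.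
apply: filterS (nbhsx_ballx x d d0) => x' xx'.
by apply: dP xx' _; [exact: addP|exact: ballxx].
Qed.

Let add_p m n : add (p m) (p n) = p (m + n).
Proof.
apply: ball_eq => e e0; have [d d0] := addP (p m) (p n) e0.
by apply; exact: ballxx.
Qed.

Let addC : commutative add.
Proof.
move=> x y; apply: add_unique => e e0; have [d d0 dP] := addP y x e0.
by exists d => // m n xm yn; rewrite addnC; exact: dP.
Qed.

Let addl_continuous x : continuous (add x).
Proof. by rewrite (_ : add x = add^~ x) //; apply/funext => y; exact: addC. Qed.

(** By density of the orbit, the laws of [add] reduce to arithmetic on indices. *)
Let eq_on_orbit (h1 h2 : X -> X) : continuous h1 -> continuous h2 ->
  (forall n, h1 (p n) = h2 (p n)) -> h1 =1 h2.
Proof.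
move=> c1 c2 h12 x; apply: ball_eq => e e0.
have e20 : 0 < e / 2 by rewrite divr_gt0.
have /(minimal_orbit_dense cX hf mf x0)[n [H1 H2]] : nbhs x
    (h1 @^-1` ball (h1 x) (e / 2) `&` h2 @^-1` ball (h2 x) (e / 2)).
  by apply: filterI; [apply: c1|apply: c2]; exact: nbhsx_ballx.
by apply: (@ball_splitl _ _ (h1 (p n))) => //; rewrite h12.
Qed.

(** The identity is extended from the orbit to [X] one variable at a time, so separate continuity
    suffices. *)
Let addA : associative add.
Proof.
have A1 l m z : add (p l) (add (p m) z) = add (add (p l) (p m)) z.
  move: z; apply: eq_on_orbit => [x|x|n].
  - exact: (continuous_comp (@addl_continuous (p m) x) (@addl_continuous (p l) _)).
  - exact: addl_continuous.
  - by rewrite !add_p addnA.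
have A2 l y z : add (p l) (add y z) = add (add (p l) y) z.
  move: y; apply: eq_on_orbit => [x|x|n]; last exact: A1.
  - exact: (continuous_comp (@addr_continuous z x) (@addl_continuous (p l) _)).
  - exact: (continuous_comp (@addl_continuous (p l) x) (@addr_continuous z _)).
move=> x y z; move: x; apply: eq_on_orbit => [x|x|n]; last exact: A2.
- exact: addr_continuous.
- exact: (continuous_comp (@addr_continuous y x) (@addr_continuous z _)).
Qed.

Let add0 : left_id x0 add.
Proof.
apply: eq_on_orbit => [|x|n]; first exact: addl_continuous.
  exact: cvg_id.
by rewrite -[x0]/(p 0) add_p.
Qed.

Let f_add x : f x = add (p 1) x.
Proof.
by move: x; apply: eq_on_orbit => [||n]; [exact: cf|exact: addl_continuous|rewrite add_p].
Qed.

(* The translate [x + X] is closed, nonempty and [f]-invariant. *)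
Let opp_exists x : exists y, add y x = x0.
Proof.
have [||A0|AT] := mf (A := range (add x)).
- apply: compact_closed; first exact: metric_hausdorff.
  by apply: continuous_compact => //; apply: continuous_subspaceT; exact: addl_continuous.
- have [_ [g [_ gK _]]] := hf.
  (* Being itself a translation, [f] commutes with [add x]. *)
  have fadd y : f (add x y) = add x (f y) by rewrite !f_add addA (addC _ x) -addA.
  apply/seteqP; split => [_ [_ [y _ <-] <-]|_ [y _ <-]].
    by exists (f y).
  by exists (add x (g y)); [exists (g y)|rewrite fadd gK].
- have : range (add x) (add x x) by exists x.
  by rewrite A0.
- have [y _ xy] : range (add x) x0 by rewrite AT.
  by exists y; rewrite addC.
Qed.

Let opp x := projT1 (cid (opp_exists x)).

Let addN : left_inverse x0 opp add.
Proof. by move=> x; rewrite /opp; case: cid. Qed.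

(* The graph of [opp] is closed in a compact space. *)
Let opp_continuous : continuous opp.
Proof.
move=> x W; rewrite nbhsE => -[V [oV Vx] VW].
have /compact_near_coveringP cV : compact (~` V).
  by apply: (subclosed_compact _ cX) => //; exact: open_closedC.
(* For [x'] near [x], no point outside [V] may be an inverse of [x']; compactness of the complement
   reduces this to a local claim at each [y]. *)
suff : \forall x' \near x, ~` V `<=` (fun y => add y x' <> x0).
  apply: filterS => x' Vx'; apply: VW; apply: contrapT => /Vx'; apply; exact: addN.
apply: cV => y Vy.
(* Inverses are unique, and that of [x] lies in [V]. *)
have yx : add y x != x0.
  apply: contra_notN Vy => /eqP yx.
  have <- : opp x = y by rewrite -(add0 y) -(addN x) -addA (addC x) yx addC add0.
  by [].
have := @add_continuous (y, x).
have : nbhs (add y x) [set~ x0].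
  apply: open_nbhs_nbhs; split; last exact/eqP.
  apply: closed_openC; apply: accessible_closed_set1.
  by apply: hausdorff_accessible; exact: metric_hausdorff.
by move=> yxn /(_ _ yxn).
Qed.

Lemma equicontinuous_iter_translation :
  exists (G : topologicalZmodType) (g : G),
    [/\ hausdorff_space G, compact [set: G] &
        top_conjugate f (fun x : G => g + x)].
Proof.
have [G [phi [hG cG hphi phiD]]] := compact_group_transport
  (@metric_hausdorff _ X) cX addA addC add0 addN add_continuous opp_continuous.
by exists G, (phi (p 1)); split => //; exists phi => // x; rewrite f_add phiD.
Qed.

End orbit_addition.

Theorem proposition4p7 (R : realType) (X : metricType R) (f : X -> X)
    (X_neq0 : [set: X] !=set0) (X_compact : compact [set: X])
    (f_homeo : homeomorphism f) (f_minimal : minimal f) :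
  (forall a : R -> R -> R, family_of_scales a -> top_slow_entropy f a = 0%E) <->
  (exists (G : topologicalZmodType) (g : G),
     [/\ hausdorff_space G, compact [set: G] &
         top_conjugate f (fun x : G => g + x)]).
Proof.
split=> [h0|[G [g [hG cG fg]]] a fa].
  have ef : equicontinuous_iter f.
    apply: bounded_cover_number_equicontinuous => // e e0.
    exact: (cover_number_bounded X_neq0 X_compact f_homeo.1 h0).
  (* An arbitrary base point becomes the zero of the group. *)
  have [x0 _] := X_neq0.
  exact: (equicontinuous_iter_translation x0 X_compact f_homeo f_minimal ef).
apply: top_slow_entropy_bounded => // e e0.
apply: equicontinuous_cover_number_bounded => //.
exact: translation_equicontinuous_iter cG fg.
Qed.
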